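(* Let $m\leq n$ be integers and let $G=(V,E)$ be the $(m+1)\times(n+1)$ rectangular grid: $V=\{1,\dots,m+1\}\times\{1,\dots,n+1\}$, and two vertices $(a,b)$ and $(a',b')$ form an edge if $|a-a'|+|b-b'|=1$. Then $\operatorname{gon}(G)=\operatorname{tw}(G)=m+1$.
   Context: Let $G=(V,E)$ be a finite connected loopless graph. For $u\ne v$ let $E(u,v)$ be the set of edges between $u$ and $v$. The Laplacian $Q(G)\in\mathbb{Z}^{V\times V}$ has $Q_{vv}=$ degree of $v$ and $Q_{uv}=-|E(u,v)|$ for $u\neq v$. A divisor on $G$ is a vector $D\in\mathbb{Z}^V$; its degree is $\deg(D)=\sum_{v\in V}D(v)$; it is effective if $D\ge 0$. Divisors $D,D'$ are equivalent, $D\sim D'$, if $D-D'=Q(G)x$ for some $x\in\mathbb{Z}^V$. The rank of $D$ is the largest integer $k$ such that $D-D'$ is equivalent to an effective divisor for every effective divisor $D'$ of degree $k$. Thus $D$ has positive rank if and only if for every $v\in V$ there is an effective divisor $D''\sim D$ with $D''(v)\ge 1$. The gonality is $$\operatorname{gon}(G)=\min\{k : \text{there is a divisor of degree } k \text{ on } G \text{ with positive rank}\}.$$ A graph $H$ is chordal if it has no induced cycle of length at least $4$. A chordal extension of $G=(V,E)$ is a chordal graph $H$ on the same vertex set $V$ that contains $G$ as a subgraph. With $\omega(H)$ the maximum size of a clique in $H$, the treewidth is $\operatorname{tw}(G)=-1+\min\{\omega(H) : H \text{ is a chordal extension of } G\}$.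
   Formalization: The formal theorem takes m and n to be nonnegative integers with n ≥ 1; this excludes m = n = 0, the one-vertex grid, where gon(G) = 1 but tw(G) = 0, and negative values, where the vertex set is empty. *)

(* Defs.v *)
From HB Require Import structures.
From mathcomp Require Import all_boot all_order all_algebra.

Set Implicit Arguments.
Unset Strict Implicit.
Unset Printing Implicit Defensive.

Import Order.TTheory GRing.Theory Num.Theory.
Local Open Scope ring_scope.

(* [is_min A k] and [is_max A k] say that A attains its minimum, resp.
   maximum, and that this extremum is k; such a k is unique. *)
Definition is_min (A : int -> Prop) (k : int) : Prop :=
  A k /\ forall j, A j -> k <= j.

Definition is_max (A : int -> Prop) (k : int) : Prop :=
  A k /\ forall j, A j -> j <= k.

(* Parallel edges are allowed; [ends_card] rules out loops. *)
Record multigraph := Multigraph {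
  vertex : finType;
  edge : finType;
  ends : edge -> {set vertex};
  ends_card : forall e, #|ends e| = 2%N
}.

Definition edges_between (G : multigraph) (u v : vertex G) : {set edge G} :=
  [set e | ends e == [set u; v]].

Definition degree (G : multigraph) (v : vertex G) : nat :=
  #|[set e : edge G | v \in ends e]|.

Definition adjacent (G : multigraph) : rel (vertex G) :=
  [rel u v | edges_between u v != set0].

(* MathComp matrices are indexed by ordinals, so the V x V Laplacian is given
   by its entries and acts on vectors through [laplacian_mul]. *)
Definition laplacian (G : multigraph) (u v : vertex G) : int :=
  if u == v then (degree u)%:Z else - (#|edges_between u v|)%:Z.

Definition divisor (G : multigraph) := {ffun vertex G -> int}.

Definition laplacian_mul (G : multigraph) (x : divisor G) : divisor G :=
  [ffun u => \sum_(v : vertex G) laplacian u v * x v].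

Definition deg (G : multigraph) (D : divisor G) : int :=
  \sum_(v : vertex G) D v.

Definition effective (G : multigraph) (D : divisor G) : Prop :=
  forall v, 0 <= D v.

Definition equivalent (G : multigraph) (D D' : divisor G) : Prop :=
  exists x : divisor G, D - D' = laplacian_mul x.

(* For k < 0 there is no effective D' of degree k, so the condition inside
   [is_max] holds vacuously: the rank is always at least -1. *)
Definition is_rank (G : multigraph) (D : divisor G) (r : int) : Prop :=
  is_max (fun k : int =>
    forall D' : divisor G, effective D' -> deg D' = k ->
      exists D'' : divisor G, effective D'' /\ equivalent (D - D') D'') r.

Definition positive_rank (G : multigraph) (D : divisor G) : Prop :=
  exists r : int, is_rank D r /\ 0 < r.

Definition is_gonality (G : multigraph) (k : int) : Prop :=
  is_min (fun d : int =>
    exists D : divisor G, deg D = d /\ positive_rank D) k.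

(* The cycle is the list of its vertices in cyclic order; a cycle of length at
   least 3 is induced when only cyclically consecutive vertices are adjacent. *)
Definition induced_cycle (T : finType) (H : rel T) (s : seq T) : Prop :=
  [/\ uniq s, cycle H s
    & {in s &, forall x y, H x y -> (y == next s x) || (x == next s y)}].

Definition chordal (T : finType) (H : rel T) : Prop :=
  forall s : seq T, (4 <= size s)%N -> ~ induced_cycle H s.

(* Chordality and cliques depend only on adjacency, so a chordal extension is
   taken to be a simple graph, given by its adjacency relation. *)
Definition chordal_extension (G : multigraph) (H : rel (vertex G)) : Prop :=
  [/\ symmetric H, irreflexive H, chordal H & subrel (@adjacent G) H].

Definition clique (T : finType) (H : rel T) (A : {set T}) : bool :=
  [forall x in A, forall y in A, (x != y) ==> H x y].

Definition clique_number (T : finType) (H : rel T) : nat :=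
  \max_(A : {set T} | clique H A) #|A|.

Definition is_treewidth (G : multigraph) (w : int) : Prop :=
  exists k : int,
    is_min (fun c : int => exists H : rel (vertex G),
      chordal_extension H /\ (clique_number H)%:Z = c) k
    /\ w = -1 + k.

(* Coordinates start at 0. *)
Definition grid_vertex (m n : nat) : finType := ('I_m.+1 * 'I_n.+1)%type.

Definition grid_rel (m n : nat) : rel (grid_vertex m n) :=
  [rel x y : grid_vertex m n | `|(x.1 : nat)%:Z - (y.1 : nat)%:Z|
             + `|(x.2 : nat)%:Z - (y.2 : nat)%:Z| == 1].

Definition grid_edge (m n : nat) : finType :=
  {A : {set grid_vertex m n}
     | [exists x, exists y, grid_rel x y && (A == [set x; y])]}.

Lemma grid_ends_card (m n : nat) (e : grid_edge m n) : #|val e| = 2%N.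
Proof.
case: e => A /= /existsP[x /existsP[y /andP[xy /eqP->]]].
rewrite cards2; case: eqVneq xy => // <-.
by rewrite /grid_rel /= !subrr.
Qed.

Definition grid (m n : nat) : multigraph := Multigraph (@grid_ends_card m n).

(* Main.v *)
(* Lower bounds: the crosses (a row together with a column) are connected and
   pairwise intersecting, and a set hitting all of them meets every row or every
   column.  Firing level sets turns a divisor of positive rank into an
   equivalent effective one whose support hits all crosses, so its degree is at
   least m+1.  For treewidth, the crosses of the m x n subgrid, the last row and
   the rest of the last column are connected and pairwise touching; in a chordal
   graph some clique hits every member of such a family, by induction on the
   removal of a simplicial vertex, and here it needs m+2 vertices.

   Upper bounds: all columns are equivalent divisors of degree m+1, and joining
   the vertices at distance at most m+1 in column-by-column order gives a
   chordal extension with cliques of size at most m+2. *)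
Require Import Defs.
From mathcomp Require Import all_boot all_order all_algebra.
From mathcomp Require Import zify ring.
From Stdlib Require Import Classical.

Set Implicit Arguments.
Unset Strict Implicit.
Unset Printing Implicit Defensive.

Import Order.TTheory GRing.Theory Num.Theory.

(** * Chordal graphs: simplicial vertices and brambles *)

Section ChordlessPaths.
Variables (T : finType) (e : rel T).
Hypothesis e_irr : irreflexive e.

Fixpoint chordless (x : T) (p : seq T) : bool :=
  if p is y :: p' then
    [&& e x y, x \notin p, ~~ has (e x) p' & chordless y p']
  else true.

Lemma chordless_path x p : chordless x p -> path e x p.
Proof. by elim: p x => //= y p IH x /and4P[-> _ _ /IH]. Qed.

Lemma chordless_uniq x p : chordless x p -> uniq (x :: p).
Proof. by elim: p x => // y p IH x /and4P[_ xp _ /IH up]; rewrite /= xp. Qed.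

(** Shortcut: [x] is attached to its last neighbour on the path, and the vertices before that
    neighbour are dropped. *)
Lemma chordless_cons x y p :
    chordless y p -> x \notin y :: p -> has (e x) (y :: p) ->
  exists q, [/\ chordless x q, last x q = last y p & {subset q <= y :: p}].
Proof.
elim: p y => [|z p IH] y cp xp hp.
  by exists [:: y]; split=> //=; move: hp xp; rewrite /= orbF => -> ->.
have [hz|hz] := boolP (has (e x) (z :: p)).
  have cz : chordless z p by case/and4P: cp.
  have xz : x \notin z :: p by move: xp; rewrite inE negb_or => /andP[].
  have [q [cq lq sq]] := IH z cz xz hz.
  by exists q; split=> // t /sq tp; rewrite inE tp orbT.
exists (y :: z :: p); split=> //.
have exy : e x y by move: hp; rewrite /= in hz *; case: (e x y) => //=;
  rewrite (negbTE hz).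
by apply/and4P.
Qed.

Lemma exists_chordless x p : path e x p ->
  exists q, [/\ chordless x q, last x q = last x p & {subset q <= p}].
Proof.
(* Repetitions are removed first, so that [x] stays off the path built from the tail. *)
case/shortenP=> p' pp' up' sp'.
suff [q [cq lq sq]] : exists q,
    [/\ chordless x q, last x q = last x p' & {subset q <= p'}].
  by exists q; split=> // t /sq/sp'.
elim: p' x pp' up' {p sp'} => [|y p IH] x /=; first by exists [::].
case/andP=> exy pp /andP[xp up].
have [q [cq lq sq]] := IH y pp up.
have xq : x \notin y :: q.
  apply: contra xp; rewrite !inE => /orP[->//|/sq->]; exact: orbT.
have hq : has (e x) (y :: q) by rewrite /= exy.
have [r [cr lr sr]] := chordless_cons cq xq hq.
exists r; split=> //; first by rewrite lr.
by move=> t /sr; rewrite !inE => /orP[->//|/sq->]; rewrite orbT.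
Qed.

Lemma chordless_index x p a b : symmetric e -> chordless x p ->
    a \in x :: p -> b \in x :: p -> e a b ->
  index b (x :: p) = (index a (x :: p)).+1 \/
  index a (x :: p) = (index b (x :: p)).+1.
Proof.
move=> e_sym; elim: p x => [|y p IH] x cp.
  by rewrite !inE => /eqP-> /eqP->; rewrite e_irr.
case/and4P: cp => exy xp hp cp.
have head c : c \in y :: p -> e x c -> index c (x :: y :: p) = 1.
  rewrite inE => /orP[/eqP->|cp' exc].
    by move: xp; rewrite inE negb_or /= => /andP[/negbTE-> _] _; rewrite eqxx.
  by case/hasP: hp; exists c.
have i0 : index x (x :: y :: p) = 0 by rewrite /= eqxx.
have iS c : c != x -> index c (x :: y :: p) = (index c (y :: p)).+1.
  by rewrite eq_sym /= => /negbTE->.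
rewrite !(in_cons x); case: (eqVneq a x) => [->|nax].
  move=> _; case: (eqVneq b x) => [->|nbx] bp exb; first by rewrite e_irr in exb.
  by left; rewrite i0 head.
move=> ap; case: (eqVneq b x) => [->|nbx] bp eab.
  by right; rewrite i0 head // e_sym.
rewrite !iS //.
by case: (IH y cp ap bp eab) => ->; [left|right].
Qed.

Lemma chordless_induced_cycle v x p : symmetric e -> chordless x p ->
    v \notin x :: p -> p != [::] ->
    {in x :: p, forall y, e v y = (y == x) || (y == last x p)} ->
  induced_cycle e [:: v, x & p].
Proof.
move=> e_sym cp vp pn ev.
have us : uniq (x :: p) := chordless_uniq cp.
have xs : x \in x :: p by rewrite mem_head.
have ls : last x p \in x :: p by rewrite mem_last.
split; first by rewrite cons_uniq vp.
  by rewrite /= rcons_path chordless_path // ev // eqxx e_sym ev // eqxx orbT.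
(* The default value [v] of [nth] is the successor of the last vertex, so the wrap-around needs no
   separate formula. *)
have nxt a : a \in x :: p ->
    next [:: v, x & p] a = nth v (x :: p) (index a (x :: p)).+1.
  move=> ap; rewrite next_nth inE ap orbT.
  have va : v != a by apply: contraNneq vp => ->.
  by rewrite [index a (v :: _)]/= (negbTE va).
have ends b : b \in x :: p -> e v b ->
    (b == next [:: v, x & p] v) || (v == next [:: v, x & p] b).
  move=> bp; rewrite (ev _ bp) => /orP[/eqP->|/eqP->].
    by rewrite /= eqxx eqxx.
  apply/orP; right; rewrite nxt // index_last // nth_default //.
move=> a b; rewrite !(in_cons v).
case: (eqVneq a v) => [->|nav] ap.
  case: (eqVneq b v) => [->|nbv] bp; first by rewrite e_irr.
  exact: ends.
case: (eqVneq b v) => [->|nbv] bp.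
  by rewrite e_sym => /(ends _ ap); rewrite orbC.
move=> eab; rewrite !nxt //.
by case: (chordless_index e_sym cp ap bp eab) => <-; rewrite nth_index // eqxx ?orbT.
Qed.

End ChordlessPaths.

(** Relative to a vertex set [A], so that inductions deleting vertices can keep [e] on all of
    [T]. *)
Definition simplicial (T : finType) (e : rel T) (A : {set T}) (u : T) : Prop :=
  {in A &, forall x y, e u x -> e u y -> x != y -> e x y}.

(** * Simplicial vertices of chordal graphs *)

Section Dirac.
Variables (T : finType) (e : rel T).
Hypotheses (e_sym : symmetric e) (e_irr : irreflexive e) (e_chordal : chordal e).

(** Otherwise an induced path from [x] to [y] with interior in [W] closes up through [v], which sees
    only its two ends, to an induced cycle of length at least 4. *)
Lemma chordal_link_clique (v : T) (W : {set T}) (x y c d : T) :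
    v \notin W -> {in W, forall w, ~~ e v w} -> e v x -> e v y ->
    c \in W -> e x c -> e y d ->
    connect [rel a b | [&& e a b, a \in W & b \in W]] c d ->
  x != y -> e x y.
Proof.
move=> vW nvW evx evy cW exc eyd /connectP[p pp ld] nxy.
apply/negPn/negP => nexy.
have pW : {subset c :: p <= W}.
  elim: p c cW pp {ld exc} => [|z p IH] c cW /=;
    first by move=> _ t; rewrite inE => /eqP->.
  case/andP=> /and3P[_ _ zW] pp t; rewrite inE => /orP[/eqP->//|]; exact: IH.
have pe : path e x (rcons (c :: p) y).
  rewrite rcons_path /= exc -ld e_sym eyd andbT.
  by apply: sub_path pp => a b /and3P[].
have [q [cq lq sq]] := exists_chordless pe.
rewrite last_rcons in lq.
have evW t : t \in W -> e v t = false by move=> /nvW/negbTE.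
have vx : v != x by apply: contraTneq evx => ->; rewrite e_irr.
have vy : v != y by apply: contraTneq evy => ->; rewrite e_irr.
apply: (e_chordal (s := [:: v, x & q])).
  (* [q] has at least two vertices because [x] and [y] are distinct and not adjacent. *)
  case: q cq lq {sq} => [|a [|b q]] //= cq lq; first by rewrite lq eqxx in nxy.
  by move: cq; rewrite lq (negbTE nexy).
apply: chordless_induced_cycle => //.
- rewrite inE negb_or vx; apply/negP => /sq.
  rewrite mem_rcons inE (negbTE vy) => /pW vW'; by rewrite vW' in vW.
- by apply: contraNneq nxy => q0; rewrite -lq q0.
move=> t; rewrite lq inE; case: (eqVneq t x) => [->//|tx] /= /sq.
rewrite mem_rcons inE; case: (eqVneq t y) => [->//|ty] /= /pW; exact: evW.
Qed.

(* Dirac: the neighbours of a component [C] of the non-neighbours of [v] form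
   a clique [S], so a vertex of [C] that is simplicial in [C :|: S], found by
   induction, is simplicial in the whole graph. *)
Lemma simplicial_nonneighbor (A : {set T}) (v : T) : v \in A ->
    (exists2 w, w \in A & (w != v) && ~~ e v w) ->
  exists2 u, u \in A & [/\ u != v, ~~ e v u & simplicial e A u].
Proof.
have [n] := ubnP #|A|; elim: n A v => // n IH A v /ltnSE leA vA [w wA vw].
pose W := [set w in A | (w != v) && ~~ e v w].
have wW : w \in W by rewrite inE wA.
pose r := [rel a b | [&& e a b, a \in W & b \in W]].
have r_sym : connect_sym r.
  by apply: sym_connect_sym => a b; rewrite /= e_sym [(a \in W) && _]andbC.
pose C := [set c in W | connect r w c].
pose S := [set s in A :\: C | [exists c in C, e s c]].
have CW c : c \in C -> c \in W by rewrite inE => /andP[].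
have WA c : c \in W -> c \in A by rewrite inE => /andP[].
have vW : v \notin W by rewrite inE eqxx andbF.
have nvW : {in W, forall c, ~~ e v c} by move=> c; rewrite inE => /and3P[].
have wC : w \in C by rewrite inE wW connect0.
(* A neighbour of [C] that [v] does not see would lie in [W], hence in [C]. *)
have evS s : s \in S -> e v s.
  rewrite !inE => /andP[/andP[sC sA] /existsP[c /andP[cC esc]]].
  have cW := CW _ cC; apply/negPn/negP => nevs.
  have sv : s != v by apply: contraTneq esc => ->; exact: nvW.
  case/negP: sC; rewrite sA sv nevs /=.
  have sW : s \in W by rewrite inE sA sv nevs.
  move: cC; rewrite inE => /andP[_ wc]; apply: connect_trans wc _.
  by apply: connect1; rewrite /= e_sym esc cW.
have Scl s t : s \in S -> t \in S -> s != t -> e s t.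
  move=> sS tS; have [evs evt] := (evS _ sS, evS _ tS).
  move: sS tS; rewrite !inE => /andP[_ /existsP[c /andP[cC esc]]].
  case/andP=> _ /existsP[d /andP[dC etd]].
  apply: (chordal_link_clique vW nvW evs evt (CW _ cC) esc etd).
  move: cC dC; rewrite !inE => /andP[_ wc] /andP[_ wd].
  by apply: connect_trans wd; rewrite r_sym.
pose A' := C :|: S.
have ltA' : #|A'| < n.
  apply: leq_trans leA; apply: proper_card; apply/properP; split.
    apply/subsetP => t /setUP[/CW/WA//|]; by rewrite !inE => /andP[/andP[]].
  exists v => //; apply/negP => /setUP[/CW|/evS]; last by rewrite e_irr.
  by rewrite (negbTE vW).
(* If some [s] in [S] misses a vertex of [A'], induction at [s] gives a [u] not adjacent to [s],
   hence outside the clique [S]. If only vertices of [C] miss something, induction at such a [c]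
   gives a [u] not adjacent to [c], whereas vertices of [S] now see all of [A']. Otherwise [A'] is a
   clique and [w] serves. *)
have [u uC su] : exists2 u, u \in C & simplicial e A' u.
  have [/exists_inP[s sS /exists_inP[d dA' sd]]|nS] :=
      boolP [exists s in S, exists d in A', (d != s) && ~~ e s d].
    have sA' : s \in A' by rewrite inE sS orbT.
    have [u uA' [us nesu su]] := IH A' s ltA' sA' (ex_intro2 _ _ d dA' sd).
    exists u => //; case/setUP: uA' => // uS.
    by rewrite Scl // eq_sym in nesu.
  have [/exists_inP[c cC /exists_inP[d dA' cd]]|nC] :=
      boolP [exists c in C, exists d in A', (d != c) && ~~ e c d].
    have cA' : c \in A' by rewrite inE cC.
    have [u uA' [uc necu su]] := IH A' c ltA' cA' (ex_intro2 _ _ d dA' cd).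
    exists u => //; case/setUP: uA' => // uS.
    case/exists_inP: nS; exists u => //; apply/exists_inP; exists c => //.
    by rewrite eq_sym uc e_sym.
  exists w => // x y xA' yA' _ _ nxy; apply/negPn/negP => nexy.
  case/setUP: xA' => [xC|xS].
    case/exists_inP: nC; exists x => //; apply/exists_inP; exists y => //.
    by rewrite eq_sym nxy.
  case/exists_inP: nS; exists x => //; apply/exists_inP; exists y => //.
  by rewrite eq_sym nxy.
have uW := CW _ uC.
have nbr x : x \in A -> e u x -> x \in A'.
  move=> xA eux; rewrite in_setU; have [//|xC] := boolP (x \in C).
  rewrite inE in_setD xC xA; apply/existsP; exists u.
  by rewrite uC e_sym.
exists u; first exact: WA.
split; [by move: uW; rewrite inE => /and3P[]|exact: nvW|].
by move=> x y xA yA eux euy; apply: su => //; apply: nbr.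
Qed.

Lemma chordal_simplicial (A : {set T}) :
  A != set0 -> exists2 u, u \in A & simplicial e A u.
Proof.
case/set0Pn=> v vA.
have [/exists_inP[x xA /exists_inP[y yA xy]]|nA] :=
    boolP [exists x in A, exists y in A, (y != x) && ~~ e x y].
  have [u uA [_ _ su]] := simplicial_nonneighbor xA (ex_intro2 _ _ y yA xy).
  by exists u.
exists v => // x y xA yA _ _ nxy; apply/negPn/negP => nexy.
case/exists_inP: nA; exists x => //; apply/exists_inP; exists y => //.
by rewrite eq_sym nxy.
Qed.

End Dirac.

(** Stated through predicates that propagate along edges rather than through paths, which suits
    unions and vertex deletions. The empty set counts as connected. *)
Definition connected_in (T : finType) (e : rel T) (B : {set T}) : Prop :=
  forall P : pred T, {in B &, forall x y, e x y -> P x -> P y} ->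
    {in B &, forall x y, P x -> P y}.

Definition touching (T : finType) (e : rel T) (A B : {set T}) : Prop :=
  exists x y, [/\ x \in A, y \in B & (x == y) || e x y].

Lemma touching_sym (T : finType) (e : rel T) (A B : {set T}) :
  symmetric e -> touching e A B -> touching e B A.
Proof. by move=> e_sym [x [y [xA yB xy]]]; exists y, x; rewrite eq_sym e_sym. Qed.

Lemma connected_in_subrel (T : finType) (e e' : rel T) (B : {set T}) :
  subrel e e' -> connected_in e B -> connected_in e' B.
Proof. by move=> ee' cB P cP; apply: cB => x y xB yB /ee'; exact: cP. Qed.

Lemma connected_inU (T : finType) (e : rel T) (A B : {set T}) :
  connected_in e A -> connected_in e B -> A :&: B != set0 ->
  connected_in e (A :|: B).
Proof.
move=> cA cB /set0Pn[z /setIP[zA zB]] P cP.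
have PA : {in A &, forall x y, P x -> P y}.
  by apply: cA => x y xA yA; apply: cP; rewrite inE ?xA ?yA.
have PB : {in B &, forall x y, P x -> P y}.
  by apply: cB => x y xB yB; apply: cP; rewrite inE ?xB ?yB orbT.
move=> x y /setUP[xA|xB] /setUP[yA|yB] Px.
- exact: PA Px.
- by apply: (PB z) => //; apply: PA Px.
- by apply: (PA z) => //; apply: PB Px.
- exact: PB Px.
Qed.

Lemma connected_in_path (T : finType) (e : rel T) (f : nat -> T) (k : nat)
    (B : {set T}) : symmetric e ->
    {in B, forall x, exists2 i, i < k & x = f i} ->
    (forall i, i < k -> f i \in B) ->
    (forall i, i.+1 < k -> e (f i) (f i.+1)) ->
  connected_in e B.
Proof.
move=> e_sym Bf fB ef P cP.
have Pf i : i < k -> P (f i) = P (f 0).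
  elim: i => // i IH ik; rewrite -IH; last exact: ltnW.
  have fi : f i \in B by apply: fB; exact: ltnW.
  have fSi := fB _ ik; have ei := ef _ ik.
  by apply/idP/idP; [apply: (cP (f i.+1))|apply: (cP (f i))]; rewrite // e_sym.
by move=> x y /Bf[i ik ->] /Bf[j jk ->]; rewrite !Pf.
Qed.

(* Being connected means that every proper part [X] of [B] has an edge to the
   rest; two neighbours of a simplicial vertex [u] are adjacent, so [u] is
   never needed for that. *)
Lemma connected_in_simplicial (T : finType) (e : rel T) (A B : {set T}) (u : T) :
    symmetric e -> simplicial e A u -> B \subset A -> connected_in e B ->
  connected_in e (B :\ u).
Proof.
move=> e_sym su /subsetP BA cB P cP.
(* Distinct neighbours of [u] in [B :\ u] are adjacent, so [P] takes one value on all of them; [P']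
   extends [P] to [u] by that value. *)
have not_both x y : x \in B :\ u -> y \in B :\ u -> e u x -> e u y -> P x -> P y.
  move=> xB yB eux euy Px; have [<-//|nxy] := eqVneq x y.
  apply: (cP x) => //; apply: su => //; apply: BA;
    [move: xB|move: yB]; by case/setD1P.
pose Pu := [exists x in B :\ u, P x && e u x].
pose P' := [pred x | if x == u then Pu else P x].
have cP' : {in B &, forall x y, e x y -> P' x -> P' y}.
  move=> x y xB yB exy; rewrite /P' /=.
  have mem z : z \in B -> z != u -> z \in B :\ u by move=> zB zu; rewrite !inE zu.
  case: (eqVneq x u) => [xu|xu]; case: (eqVneq y u) => [yu|yu] //.
  - case/exists_inP=> z zB /andP[Pz euz].
    by apply: (not_both z) => //; [exact: mem|rewrite -xu].
  - move=> Px; apply/exists_inP; exists x; first exact: mem.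
    by rewrite Px e_sym -yu.
  - by move=> Px; apply: (cP x) => //; exact: mem.
move=> x y /setD1P[xu xB] /setD1P[yu yB].
by have := cB P' cP' x y xB yB; rewrite /P' /= (negbTE xu) (negbTE yu).
Qed.

(** Without such a neighbour, the predicate of being [u] would propagate along the edges of [B]. *)
Lemma connected_in_neighbor (T : finType) (e : rel T) (B : {set T}) (u : T) :
    connected_in e B -> u \in B -> B != [set u] ->
  exists x, [/\ x \in B, x != u & e u x].
Proof.
move=> cB uB Bu.
have [/exists_inP[x xB /andP[xu eux]]|nx] :=
  boolP [exists x in B, (x != u) && e u x]; first by exists x.
case/eqP: Bu; apply/setP=> y; rewrite inE; apply/idP/eqP => [yB|->//].
apply/eqP; apply: (cB (pred1 u) _ u y uB yB) => /=; last exact: eqxx.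
move=> a b aB bB eab /eqP au; apply/negPn/negP => bu.
by case/exists_inP: nx; exists b => //; rewrite bu -au.
Qed.

(** Let [u] be simplicial in [A]. If the singleton of [u] is a member, its closed neighbourhood in
    [A] is a clique, and it meets every member since all touch [u]. Otherwise [u] is deleted from
    all members, which stay nonempty, connected and touching. *)
Lemma bramble_clique (T : finType) (e : rel T) (A : {set T})
    (Bs : {set {set T}}) :
    symmetric e -> irreflexive e -> chordal e ->
    {in Bs, forall B : {set T}, [/\ B \subset A, B != set0 & connected_in e B]} ->
    {in Bs &, forall B B' : {set T}, touching e B B'} ->
  exists K, clique e K /\ {in Bs, forall B : {set T}, B :&: K != set0}.
Proof.
move=> e_sym e_irr e_chordal.
have [n] := ubnP #|A|; elim: n A Bs => // n IH A Bs /ltnSE leA hBs tBs.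
have [A0|/(chordal_simplicial e_sym e_irr e_chordal)[u uA su]] := eqVneq A set0.
  exists set0; split; first by apply/forall_inP => x; rewrite inE.
  by move=> B /hBs[]; rewrite A0 subset0 => /eqP->; rewrite eqxx.
have [uBs|uBs] := boolP ([set u] \in Bs).
  exists [set x in A | (x == u) || e u x]; split.
    apply/forall_inP => x; rewrite inE => /andP[xA xu].
    apply/forall_inP => y; rewrite inE => /andP[yA yu].
    apply/implyP => nxy; case/orP: xu nxy => [/eqP->|eux].
      by case/orP: yu => [/eqP->|//]; rewrite eqxx.
    case/orP: yu => [/eqP->|euy] nxy; first by rewrite e_sym.
    exact: su.
  move=> B BBs; have [x [y [/set1P-> yB uy]]] := tBs _ _ uBs BBs.
  have [/subsetP/(_ _ yB) yA _ _] := hBs _ BBs.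
  by apply/set0Pn; exists y; rewrite !inE yB yA eq_sym.
have nbr B : B \in Bs -> u \in B -> exists x, [/\ x \in B, x != u & e u x].
  move=> BBs uB; have [_ _ cB] := hBs _ BBs.
  by apply: connected_in_neighbor => //; apply: contraNneq uBs => <-.
have mem B x : B \in Bs -> x \in B -> x \in A.
  by case/hBs => /subsetP BA _ _ /BA.
have [||| K [cK hK]] := IH (A :\ u) [set B :\ u | B : {set T} in Bs].
- by move: leA; rewrite (cardsD1 u A) uA.
- move=> _ /imsetP[B BBs ->]; have [BA B0 cB] := hBs _ BBs; split.
  + exact: setSD.
  + have [uB|uB] := boolP (u \in B).
      have [x [xB xu _]] := nbr _ BBs uB.
      by apply/set0Pn; exists x; rewrite !inE xu.
    by case/set0Pn: B0 => x xB; apply/set0Pn; exists x; rewrite !inE xB (memPn uB).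
  + exact: connected_in_simplicial su BA cB.
(* Contact through [u] is rerouted: a neighbour of [u] in [B] and one in [B'] are equal or
   adjacent. *)
- have half B B' y : B \in Bs -> B' \in Bs -> u \in B -> y \in B' ->
      (u == y) || e u y -> touching e (B :\ u) (B' :\ u).
    move=> BBs BBs' uB yB uy; have [x [xB xu eux]] := nbr _ BBs uB.
    have [z [zB zu euz]] : exists z, [/\ z \in B', z != u & e u z].
      case: (eqVneq u y) uy yB => /= [<- _|uy' euy] yB; first exact: nbr.
      by exists y; rewrite eq_sym.
    exists x, z; rewrite !inE xu zu xB zB; split=> //.
    have [//|nxz] := eqVneq x z; apply: su => //; [exact: (mem B)|exact: (mem B')].
  move=> _ _ /imsetP[B BBs ->] /imsetP[B' BBs' ->].
  have [x [y [xB yB xy]]] := tBs _ _ BBs BBs'.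
  have [xu|xu] := eqVneq x u; first by subst x; exact: half xy.
  have [yu|yu] := eqVneq y u.
    subst y; apply: touching_sym => //.
    by apply: (half _ _ x) => //; rewrite eq_sym e_sym.
  by exists x, y; rewrite !inE xu yu xB yB.
exists K; split=> // B BBs.
have /set0Pn[x] : (B :\ u) :&: K != set0 by apply: hK; exact: imset_f.
by rewrite !inE => /andP[/andP[_ xB] xK]; apply/set0Pn; exists x; rewrite inE xB.
Qed.

(** * Divisors and strict brambles *)

Section Divisors.
Local Open Scope ring_scope.
Variable G : multigraph.
Implicit Types (u v w : vertex G) (D E F x : divisor G).

Lemma edges_betweenC u v : edges_between u v = edges_between v u.
Proof. by apply/setP => e; rewrite !inE setUC. Qed.

Lemma adjacentE u v : adjacent u v = (0 < #|edges_between u v|)%N.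
Proof. by rewrite /adjacent /= card_gt0. Qed.

Lemma adjacent_sym : symmetric (@adjacent G).
Proof. by move=> u v; rewrite !adjacentE edges_betweenC. Qed.

(** Every edge at [u] has exactly one other end, so it is counted for exactly one [v]. *)
Lemma degree_edges_between u :
  degree u = (\sum_(v | v != u) #|edges_between u v|)%N.
Proof.
rewrite /degree -sum1_card big_mkcond /=.
under [RHS]eq_bigr => v _ do rewrite -sum1_card big_mkcond /=.
rewrite exchange_big /=; apply: eq_bigr => e _; rewrite inE.
under eq_bigr => v _ do rewrite inE.
have /eqP/cards2P[a [b [nab eab]]] := ends_card e.
have eq_pair c d v : c != d -> v != c ->
    ([set c; d] == [set c; v]) = (v == d).
  move=> ncd nvc; apply/eqP/eqP => [/setP/(_ v)|->//].
  by rewrite !inE eqxx orbT (negbTE nvc) /= => /eqP.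
have one (c d : vertex G) : c != d ->
    (\sum_(v | v != c) (if [set c; d] == [set c; v] then 1 else 0) = 1)%N.
  move=> ncd; rewrite (bigD1 d) 1?eq_sym //= eqxx big1 // => v /andP[vc vd].
  by rewrite eq_pair // (negbTE vd).
rewrite eab !inE; have [->|ua] := eqVneq u a; first by rewrite one.
have [->|ub] := eqVneq u b; first by rewrite setUC one 1?eq_sym.
rewrite big1 // => v _; case: eqP => // /setP/(_ u).
by rewrite !inE eqxx (negbTE ua) (negbTE ub).
Qed.

(** The rows of the Laplacian sum to zero, so only differences of [x] along edges matter; the firing
    computations use this form. *)
Lemma laplacian_mulE x u :
  laplacian_mul x u = \sum_v (#|edges_between u v|)%:Z * (x u - x v).
Proof.
rewrite ffunE (bigD1 u) //= [RHS](bigD1 u) //= subrr mulr0 add0r.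
rewrite /laplacian eqxx degree_edges_between (big_morph Posz PoszD (erefl _)).
rewrite mulr_suml -big_split /=; apply: eq_bigr => v vu.
by rewrite eq_sym (negbTE vu); ring.
Qed.

(* The pointwise operations with value type [int] on the nose, which [lia]
   needs and [ffunE] does not give. *)
Lemma divisorD D E v : (D + E) v = D v + E v.
Proof. by rewrite ffunE. Qed.

Lemma divisorB D E v : (D - E) v = D v - E v.
Proof. by rewrite !ffunE. Qed.

Lemma laplacian_mulD x y :
  laplacian_mul (x + y) = laplacian_mul x + laplacian_mul y.
Proof.
apply/ffunP => u; rewrite !ffunE -big_split; apply: eq_bigr => v _.
by rewrite !ffunE mulrDr.
Qed.

Lemma laplacian_mulN x : laplacian_mul (- x) = - laplacian_mul x.
Proof.
apply/ffunP => u; rewrite !ffunE -sumrN; apply: eq_bigr => v _.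
by rewrite !ffunE mulrN.
Qed.

Lemma laplacian_mul_const (c : int) : laplacian_mul [ffun=> c] = 0 :> divisor G.
Proof.
apply/ffunP => u; rewrite laplacian_mulE [RHS]ffunE big1 // => v _.
by rewrite !ffunE subrr mulr0.
Qed.

Lemma deg_laplacian_mul x : deg (laplacian_mul x) = 0.
Proof.
(* Exchanging [u] and [v] changes the sign of every term. *)
have sk : deg (laplacian_mul x) = - deg (laplacian_mul x).
  rewrite /deg -sumrN; under eq_bigr => u _ do rewrite laplacian_mulE.
  under [RHS]eq_bigr => u _ do rewrite laplacian_mulE -sumrN.
  rewrite [RHS]exchange_big; apply: eq_bigr => u _; apply: eq_bigr => v _.
  by rewrite edges_betweenC; ring.
lia.
Qed.

Lemma degD D E : deg (D + E) = deg D + deg E.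
Proof. by rewrite /deg -big_split; apply: eq_bigr => v _; rewrite ffunE. Qed.

Lemma degN D : deg (- D) = - deg D.
Proof. by rewrite /deg -sumrN; apply: eq_bigr => v _; rewrite ffunE. Qed.

Lemma equivalent_refl D : equivalent D D.
Proof. by exists [ffun=> 0]; rewrite subrr laplacian_mul_const. Qed.

Lemma equivalent_sym D E : equivalent D E -> equivalent E D.
Proof. by case=> x Dx; exists (- x); rewrite laplacian_mulN -Dx opprB. Qed.

Lemma equivalent_trans D E F : equivalent D E -> equivalent E F -> equivalent D F.
Proof.
by case=> x Dx [y Ey]; exists (x + y); rewrite laplacian_mulD -Dx -Ey addrA subrK.
Qed.

Lemma equivalent_addr D E F : equivalent D E -> equivalent (D + F) (E + F).
Proof. by case=> x Dx; exists x; rewrite -Dx opprD addrACA subrr addr0. Qed.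

Lemma equivalent_deg D E : equivalent D E -> deg D = deg E.
Proof.
case=> x /(congr1 (@deg G)).
by rewrite degD degN deg_laplacian_mul => /subr0_eq.
Qed.

Lemma effective_deg_ge0 D : effective D -> 0 <= deg D.
Proof. by move=> D0; apply: sumr_ge0 => v _. Qed.

Lemma effective_le_deg D v : effective D -> D v <= deg D.
Proof.
by move=> D0; rewrite /deg (bigD1 v) //= lerDl; apply: sumr_ge0 => w _; exact: D0.
Qed.

Lemma effective_le_deg2 D v w : effective D -> w != v -> D w + D v <= deg D.
Proof.
move=> D0 wv; rewrite /deg (bigD1 v) //= (bigD1 w) //= [leLHS]addrC addrA lerDl.
by apply: sumr_ge0 => i _; exact: D0.
Qed.

Definition chips_at v (k : int) : divisor G := [ffun w => if w == v then k else 0].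

Lemma deg_chips_at v k : deg (chips_at v k) = k.
Proof.
rewrite /deg (bigD1 v) //= ffunE eqxx big1 ?addr0 // => w /negbTE wv.
by rewrite ffunE wv.
Qed.

Lemma effective_chips_at v k : 0 <= k -> effective (chips_at v k).
Proof. by move=> k0 w; rewrite ffunE; case: ifP. Qed.

(** The rank condition is tested on [r] chips at [v], which are then added back to the effective
    divisor obtained. *)
Lemma positive_rank_reach D v : positive_rank D ->
  exists E, [/\ effective E, equivalent D E & 0 < E v].
Proof.
case=> r [[rkD _] r0].
have [E [E0 DE]] :=
  rkD _ (effective_chips_at v (ltW r0)) (deg_chips_at v r).
exists (E + chips_at v r); split.
- by move=> w; rewrite ffunE addr_ge0 // effective_chips_at ?ltW.
- by have := equivalent_addr (chips_at v r) DE; rewrite subrK.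
- by rewrite !ffunE eqxx ltr_wpDl.
Qed.

(** Supplies the exact rank that [is_rank] asks for; [A] is an arbitrary predicate, hence the
    excluded middle. *)
Lemma bounded_int_max (A : int -> Prop) (a b : int) : A a ->
  (forall k, A k -> k <= b) -> exists r, is_max A r /\ a <= r.
Proof.
move=> Aa Ab; have ab := Ab _ Aa.
have [n] := ubnP `|b - a|%N; elim: n a Aa ab => // n IH a Aa ab ltn.
have [[c [Ac ac]]|nA] := classic (exists c, A c /\ a < c).
  have cb := Ab _ Ac.
  have [|r [rA cr]] := IH c Ac cb; first by lia.
  by exists r; split=> //; lia.
exists a; split=> //; split=> // j Aj; rewrite leNgt; apply/negP => aj.
by case: nA; exists j.
Qed.

(** The rank condition holds at 1, and it fails above [deg D], as [deg D] + 1 or more chips at [v0]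
    would leave a negative degree. *)
Lemma reach_positive_rank D v0 : 0 <= deg D ->
    (forall v, exists E, [/\ effective E, equivalent D E & 0 < E v]) ->
  positive_rank D.
Proof.
move=> D0 reach; pose A (k : int) := forall D' : divisor G,
  effective D' -> deg D' = k ->
    exists D'' : divisor G, effective D'' /\ equivalent (D - D') D''.
suff [r [rA r1]] : exists r, is_max A r /\ 1 <= r by exists r.
apply: (@bounded_int_max _ _ (deg D)).
  move=> D' eD' dD'.
  (* An effective [D'] of degree 1 is a single chip at some [v], and an [E] with a chip there can
     spare it. *)
  have [v v1] : exists v, 0 < D' v.
    apply: NNPP => nv; suff : deg D' = 0 by rewrite dD'.
    apply: big1 => v _; apply/eqP; rewrite eq_le eD' andbT leNgt.
    by apply/negP => v1; apply: nv; exists v.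
  have [E [E0 DE Ev]] := reach v.
  exists (E - D'); split; last exact: equivalent_addr.
  move=> w; rewrite divisorB subr_ge0; have [->|wv] := eqVneq w v.
    by have := effective_le_deg v eD'; rewrite dD'; lia.
  apply: le_trans (E0 w); have := effective_le_deg2 eD' wv; rewrite dD'; lia.
move=> k Ak; rewrite leNgt; apply/negP => kD.
have k0 : 0 <= k by lia.
have [E [E0 /equivalent_deg]] := Ak _ (effective_chips_at v0 k0) (deg_chips_at v0 k).
by rewrite degD degN deg_chips_at; have := effective_deg_ge0 E0; lia.
Qed.

(** * Firing the level sets of a potential *)

Section Firing.
Variables (D E : divisor G) (g : vertex G -> nat).
Hypotheses (D_eff : effective D) (E_eff : effective E).
Hypothesis DE : D - E = laplacian_mul [ffun v => (g v)%:Z].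

(** Thanks to truncated subtraction, this is the stage at which the level sets [k < g] with [k >= c]
    have been fired. As [c] decreases, the chain runs from [D] to [E], and passing from [c.+1] to
    [c] fires the set [c < g]. *)
Definition fire_above (c : nat) : divisor G :=
  D - laplacian_mul [ffun v => (g v - c)%N%:Z].

Lemma fire_aboveE c u : fire_above c u =
  D u - \sum_v (#|edges_between u v|)%:Z * ((g u - c)%N%:Z - (g v - c)%N%:Z).
Proof.
rewrite /fire_above divisorB laplacian_mulE.
by congr (_ - _); apply: eq_bigr => v _; rewrite !ffunE.
Qed.

Lemma fire_above0 : fire_above 0 = E.
Proof.
rewrite /fire_above; under eq_ffun do rewrite subn0.
by rewrite -DE opprB addrC subrK.
Qed.

Lemma fire_above_big c : (forall v, g v <= c)%N -> fire_above c = D.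
Proof.
move=> gc; apply/ffunP => u; rewrite fire_aboveE big1 ?subr0 // => v _.
by rewrite (eqP (gc u)) (eqP (gc v)) subrr mulr0.
Qed.

Lemma fire_above_equivalent c : equivalent D (fire_above c).
Proof. by eexists; rewrite opprB addrC subrK. Qed.

(** A vertex with [g u <= c] has only received chips since [D]; one with [c < g u] will only lose
    chips on the way to [E]. *)
Lemma fire_above_effective c : effective (fire_above c).
Proof.
move=> u; have [gc|cg] := leqP (g u) c.
  rewrite fire_aboveE; have := D_eff u; rewrite (eqP gc).
  suff : 0 <= - \sum_v (#|edges_between u v|)%:Z * (0%N%:Z - (g v - c)%N%:Z) by lia.
  rewrite -sumrN; apply: sumr_ge0 => v _; rewrite sub0r mulrN opprK.
  by apply: mulr_ge0.
have := E_eff u; rewrite -fire_above0 !fire_aboveE => /le_trans -> //.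
rewrite lerD2l lerN2; apply: ler_sum => v _; apply: ler_wpM2l => //; lia.
Qed.

Lemma fire_aboveS c u : fire_above c u = fire_above c.+1 u -
  \sum_v (#|edges_between u v|)%:Z * ((c < g u)%N%:Z - (c < g v)%N%:Z).
Proof.
rewrite !fire_aboveE -addrA -opprD -big_split /=; congr (_ - _).
apply: eq_bigr => v _; rewrite -mulrDr; congr (_ * _); lia.
Qed.

Lemma fire_above_le c u : (c < g u)%N -> fire_above c u <= fire_above c.+1 u.
Proof.
move=> cu; rewrite fire_aboveS cu gerBl; apply: sumr_ge0 => v _.
by apply: mulr_ge0 => //; lia.
Qed.

Lemma fire_above_ge c u : (g u <= c)%N -> fire_above c.+1 u <= fire_above c u.
Proof.
move=> cu; rewrite [leRHS]fire_aboveS lerDl -sumrN; apply: sumr_ge0 => v _.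
rewrite -mulrN; apply: mulr_ge0 => //; lia.
Qed.

(** The firing step sends a chip from [u] to [v]. As [u] does not go into debt it had a chip before,
    and as [v] was not in debt it has one after. *)
Lemma fire_above_boundary c u v : (c < g u)%N -> (g v <= c)%N -> adjacent u v ->
  0 < fire_above c.+1 u /\ 0 < fire_above c v.
Proof.
rewrite adjacentE => cu cv uv; split.
  have := fire_above_effective c u; rewrite fire_aboveS subr_ge0.
  apply: lt_le_trans; rewrite (bigD1 v) //= ltr_pwDl //.
    by rewrite cu ltnNge cv mulr1.
  by apply: sumr_ge0 => w _; apply: mulr_ge0 => //; lia.
rewrite fire_aboveS ltr_wpDl //; first exact: fire_above_effective.
rewrite -sumrN (bigD1 u) //= ltr_pwDl //.
  by rewrite cu ltnNge cv mulrN1 opprK edges_betweenC.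
by apply: sumr_ge0 => w _; rewrite -mulrN; apply: mulr_ge0 => //; lia.
Qed.

End Firing.

(** * Families of pairwise intersecting connected sets *)

Definition hits D (B : {set vertex G}) := [exists v in B, 0 < D v].

(** An edge inside [B] leaving the fired set would make [B] hit both before and after the step, so
    [B] lies on one side. *)
Lemma level_constant D E g c (B : {set vertex G}) :
    effective D -> effective E -> D - E = laplacian_mul [ffun v => (g v)%:Z] ->
    connected_in (@adjacent G) B ->
    ~~ hits (fire_above D g c.+1) B || ~~ hits (fire_above D g c) B ->
  {in B &, forall u v, (c < g u)%N -> (c < g v)%N}.
Proof.
move=> D0 E0 DE cB nh.
apply: (cB [pred u | (c < g u)%N]) => u v uB vB uv /= cu.
rewrite ltnNge; apply/negP => cv.
have [Du Dv] := fire_above_boundary D0 E0 DE cu cv uv.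
by case/orP: nh => /existsP; case; [exists u; rewrite uB|exists v; rewrite vB].
Qed.

(** Adding the constant [M] makes the potential nonnegative and does not change its image under the
    Laplacian. *)
Lemma equivalent_nat D E : equivalent D E ->
  exists g : vertex G -> nat, D - E = laplacian_mul [ffun v => (g v)%:Z].
Proof.
case=> x ->; pose M := (\sum_v `|x v|%N)%N.
exists (fun v => absz (x v + M%:Z)).
have -> : [ffun v => (absz (x v + M%:Z))%:Z] = x + [ffun=> M%:Z].
  apply/ffunP => v; rewrite divisorD !ffunE.
  have : (absz (x v) <= M)%N by rewrite /M (bigD1 v) //= leq_addr.
  lia.
by rewrite laplacian_mulD laplacian_mul_const addr0.
Qed.

(* Let [c] be the level at which the chain from [D] to [E] first hits [B];
   then [B] lies outside all sets fired so far, whereas a set that stops being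
   hit lies inside the set just fired. *)
Lemma hits_progress D E (Bs : {set {set vertex G}}) (B : {set vertex G}) :
    effective D -> effective E -> equivalent D E ->
    {in Bs, forall B' : {set vertex G}, connected_in (@adjacent G) B'} ->
    {in Bs &, forall B1 B2 : {set vertex G}, B1 :&: B2 != set0} ->
    B \in Bs -> ~~ hits D B -> hits E B ->
  exists F, [/\ effective F, equivalent D F, hits F B &
    {in Bs, forall B' : {set vertex G}, hits D B' -> hits F B'}].
Proof.
move=> D0 E0 /equivalent_nat[g DE] cBs iBs BBs nDB EB.
have [M gM] : exists M, forall v, (g v <= M)%N.
  by exists (\max_v g v) => v; exact: (leq_bigmax v).
have DM k : fire_above D g (M + k) = D.
  by apply: fire_above_big => v; apply: leq_trans (gM v) _; exact: leq_addr.
have [c [hc nhc]] : exists c, hits (fire_above D g c) B /\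
    forall k, ~~ hits (fire_above D g (c.+1 + k)) B.
  have ex0 : exists c, hits (fire_above D g c) B.
    by exists 0%N; rewrite (fire_above0 DE).
  have bnd c : hits (fire_above D g c) B -> (c <= M)%N.
    move=> hc; rewrite leqNgt; apply/negP => Mc; move: hc.
    by rewrite -(subnKC (ltnW Mc)) DM (negbTE nDB).
  have [c hc cmax] := ex_maxnP ex0 bnd.
  by exists c; split=> // k; apply/negP => /cmax; lia.
(* If [B] met the set fired in the step to [c], then, not being hit at [c.+1], it would lie inside
   that set and only lose chips, so it would not be hit at [c]. *)
have Bc : {in B, forall u, (g u <= c)%N}.
  case/exists_inP: hc => w wB hw u uB; rewrite leqNgt; apply/negP => cu.
  have nh := nhc 0%N; rewrite addn0 in nh.
  have cw : (c < g w)%N.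
    by apply: (level_constant D0 E0 DE (cBs _ BBs) _ uB wB cu); rewrite nh.
  case/exists_inP: nh; exists w => //.
  exact: lt_le_trans hw (fire_above_le _ cw).
exists (fire_above D g c); split=> //.
- exact: fire_above_effective DE _.
- exact: fire_above_equivalent.
move=> B' BBs' DB'.
(* [k] counts firing steps, from level [c + M], where the divisor is still [D], down to level
   [c]. *)
suff hk k : (k <= M)%N -> hits (fire_above D g (c + (M - k))) B'.
  by have := hk M (leqnn M); rewrite subnn addn0.
elim: k => [_|k IH kM]; first by rewrite subn0 addnC DM.
set d := (c + (M - k.+1))%N.
have {IH} : hits (fire_above D g d.+1) B'.
  by rewrite (_ : d.+1 = c + (M - k))%N ?IH /d //; lia.
case/exists_inP=> w wB' hw; have [//|nh] := boolP (hits (fire_above D g d) B').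
have dw : (d < g w)%N.
  rewrite ltnNge; apply/negP => wd; case/negP: nh; apply/exists_inP; exists w => //.
  exact: lt_le_trans hw (fire_above_ge _ wd).
have /set0Pn[z /setIP[zB zB']] := iBs _ _ BBs BBs'.
have : (d < g z)%N.
  by apply: (level_constant D0 E0 DE (cBs _ BBs') _ wB' zB' dw); rewrite nh orbT.
have := Bc z zB; rewrite /d; lia.
Qed.

(** Each use of [hits_progress], aimed at a divisor with a chip on a missed member, strictly lowers
    the number of missed members. *)
Lemma strict_bramble_hit D (Bs : {set {set vertex G}}) v0 :
    {in Bs, forall B : {set vertex G}, connected_in (@adjacent G) B} ->
    {in Bs &, forall B1 B2 : {set vertex G}, B1 :&: B2 != set0} ->
    positive_rank D ->
  exists E, [/\ effective E, equivalent D E &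
    {in Bs, forall B : {set vertex G}, hits E B}].
Proof.
move=> cBs iBs rkD.
suff loop n E : effective E -> equivalent D E ->
    (#|[set B in Bs | ~~ hits E B]| < n)%N ->
    exists F, [/\ effective F, equivalent D F &
      {in Bs, forall B : {set vertex G}, hits F B}].
  have [E [E0 DE _]] := positive_rank_reach v0 rkD.
  exact: (loop _ E E0 DE (ltnSn _)).
elim: n E => // n IH E E0 DE lt_n.
have [hE|] := boolP [forall B in Bs, hits E B].
  by exists E; split=> // B BBs; exact: (forall_inP hE).
case/forall_inPn=> B BBs nEB.
(* A member meets itself, so it is nonempty. *)
have /set0Pn[v] := iBs _ _ BBs BBs; rewrite setIid => vB.
have [F [F0 DF Fv]] := positive_rank_reach v rkD.
have EF := equivalent_trans (equivalent_sym DE) DF.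
have FB : hits F B by apply/exists_inP; exists v.
have [F' [F'0 EF' F'B hF']] := hits_progress E0 F0 EF cBs iBs BBs nEB FB.
apply: (IH F') => //; first exact: equivalent_trans EF'.
rewrite ltnS in lt_n; apply: leq_trans lt_n.
apply: proper_card; apply/properP; split.
  apply/subsetP => B'; rewrite !inE => /andP[BBs' nF]; rewrite BBs'.
  by apply: contra nF; exact: hF'.
by exists B; rewrite !inE ?BBs // F'B andbF.
Qed.

Lemma card_support_le_deg D : effective D -> (#|[set v | (0 < D v)]|)%:Z <= deg D.
Proof.
move=> D0; rewrite -sum1_card (big_morph Posz PoszD (erefl _)) big_mkcond.
apply: ler_sum => v _; rewrite inE; case: ifP => // v0; lia.
Qed.

End Divisors.

(** * Graphs of bounded bandwidth *)

Section Band.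
Variables (T : finType) (f : T -> nat) (w : nat).
Hypothesis f_inj : injective f.

Definition band : rel T :=
  [rel x y | [&& x != y, f x <= f y + w & f y <= f x + w]].

Lemma band_sym : symmetric band.
Proof. by move=> x y; rewrite /band /= eq_sym [(f x <= _) && _]andbC. Qed.

Lemma band_irr : irreflexive band.
Proof. by move=> x; rewrite /band /= eqxx. Qed.

(* The two neighbours on a cycle of its vertex with the least value of [f]
   both have values in an interval of length [w], so they are adjacent. *)
Lemma band_chordal : chordal band.
Proof.
move=> s s4 [us cs ind].
have [x0 x0s] : exists x, x \in s.
  by case: s s4 {us cs ind} => // x s _; exists x; rewrite mem_head.
have [x xs xmin] : exists2 x, x \in s & {in s, forall y, f x <= f y}.
  by have [x xs xmin] := arg_minnP f x0s; exists x.
have [i s' si] := rot_to xs.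
have {}cs : cycle band (x :: s') by rewrite -si rot_cycle.
have u's : uniq (x :: s') by rewrite -si rot_uniq.
have s'4 : 4 <= size (x :: s') by rewrite -si size_rot.
have ms : s =i x :: s' by move=> t; rewrite -si mem_rot.
have {}ind : {in x :: s' &, forall a b, band a b ->
    (b == next (x :: s') a) || (a == next (x :: s') b)}.
  by move=> a b ai bi; rewrite -!si !next_rot //; apply: ind; rewrite ms.
have {}xmin : {in x :: s', forall y, f x <= f y}.
  by move=> y; rewrite -ms; exact: xmin.
case: s' u's s'4 cs ind xmin {si ms} => [|a [|b [|c t]]] // u4 _ cs ind xmin.
pose z := last c t.
have zs : z \in [:: c & t] by exact: mem_last.
have zs' : z \in [:: x, a, b, c & t] by rewrite 3!inE zs !orbT.
have as' : a \in [:: x, a, b, c & t] by rewrite !inE eqxx orbT.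
have xa : band x a by move: cs => /= /andP[].
have zx : band z x.
  by move: cs; rewrite (cycle_path x) /= => /andP[].
have az : a != z.
  move: u4; apply: contraTneq => ->.
  by rewrite 2!cons_uniq [z \in b :: _]in_cons zs orbT andbF.
have baz : band a z.
  case/and3P: xa zx => _ _ xa /and3P[_ zx _]; rewrite /band /= az.
  by move: xa zx (xmin _ as') (xmin _ zs'); lia.
have nz : next [:: x, a, b, c & t] z = x.
  rewrite next_nth zs' -[z]/(last x [:: a, b, c & t]) index_last //.
  by rewrite nth_default.
have nax : a != x by move: u4; rewrite /= inE negb_or eq_sym => /andP[/andP[]].
have na : next [:: x, a, b, c & t] a = b.
  by rewrite next_nth as' /= [x == a]eq_sym (negbTE nax) eqxx.
(* As [a] and [z] are adjacent they must be consecutive, which forces [z] to be [b], although [z]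
   lies beyond [b] in a duplicate-free list. *)
have := ind _ _ as' zs' baz; rewrite na nz (negbTE nax) orbF => /eqP zb.
by move: u4; rewrite 3!cons_uniq -zb zs !andbF.
Qed.

(** Offsets from the least label embed a clique into the numbers from 0 to [w]. *)
Lemma band_clique_number : clique_number band <= w.+1.
Proof.
apply/bigmax_leqP => A /forall_inP cA.
have [->|[x0 x0A]] := set_0Vmem A; first by rewrite cards0.
have [x xA xmin] := arg_minnP f x0A.
have fA y : y \in A -> f y - f x < w.+1.
  move=> yA; have [->|xy] := eqVneq x y; first by rewrite subnn.
  have /forall_inP/(_ y yA)/implyP/(_ xy)/and3P[_ _] := cA _ xA; lia.
rewrite -[w.+1]card_ord; pose g y : 'I_w.+1 := inord (f y - f x).
rewrite -(card_in_imset (f := g)) ?max_card //.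
move=> y z yA zA /(congr1 val) /=; rewrite !inordK ?fA // => yz.
by apply: f_inj; have := xmin _ yA; have := xmin _ zA; lia.
Qed.

End Band.

(** * Grids *)

Section Grid.
Variables m n : nat.
Implicit Types u v : grid_vertex m n.

Lemma grid_relE u v : grid_rel u v =
  ((u.1 == v.1 :> nat) && ((u.2.+1 == v.2) || (v.2.+1 == u.2))) ||
  ((u.2 == v.2 :> nat) && ((u.1.+1 == v.1) || (v.1.+1 == u.1))).
Proof. rewrite /grid_rel /=; lia. Qed.

Lemma grid_rel_sym : symmetric (@grid_rel m n).
Proof. move=> u v; rewrite !grid_relE; lia. Qed.

Lemma card_edges_between_grid u v :
  #|edges_between (G := grid m n) u v| = grid_rel u v.
Proof.
have [uv|uv] := boolP (grid_rel u v).
  have ex : [exists x, exists y, grid_rel x y && ([set u; v] == [set x; y])].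
    by apply/existsP; exists u; apply/existsP; exists v; rewrite uv eqxx.
  apply/eqP/cards1P; exists (Sub [set u; v] ex); apply/setP => e.
  by rewrite !inE -val_eqE.
apply: eq_card0 => e; rewrite !inE; apply/negP => /eqP euv.
case/negP: uv; have /existsP[x /existsP[y /andP[xy /eqP exy]]] := valP e.
have nuv : u != v.
  by have := grid_ends_card e; rewrite [val e]euv cards2; case: (u != v).
have /set2P ux : u \in [set x; y] by rewrite -exy [val e]euv set21.
have /set2P vx : v \in [set x; y] by rewrite -exy [val e]euv set22.
case: ux vx nuv => -> [] ->; rewrite ?eqxx // => _.
by rewrite grid_rel_sym.
Qed.

Lemma adjacent_grid : @adjacent (grid m n) =2 @grid_rel m n.
Proof. by move=> u v; rewrite adjacentE card_edges_between_grid; case: grid_rel. Qed.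

(** * Rows, columns and crosses *)

Definition row_seg (i q : nat) : {set grid_vertex m n} :=
  [set u : grid_vertex m n | (u.1 == i :> nat) && (u.2 < q)].

Definition col_seg (j p : nat) : {set grid_vertex m n} :=
  [set u : grid_vertex m n | (u.2 == j :> nat) && (u.1 < p)].

(** [p] and [q] select a subgrid: the whole grid for gonality, the first [m] rows and [n] columns
    for treewidth. *)
Definition cross (p q i j : nat) := row_seg i q :|: col_seg j p.

(** [inord] sends out-of-range values to 0, so the lemmas reading off coordinates carry bounds. *)
Definition grid_pt (i j : nat) : grid_vertex m n := (inord i, inord j).

Lemma grid_ptK u : u = grid_pt u.1 u.2.
Proof. by case: u => i j; rewrite /grid_pt !inord_val. Qed.

Lemma grid_pt1 i j : i <= m -> (grid_pt i j).1 = i :> nat.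
Proof. exact: inordK. Qed.

Lemma grid_pt2 i j : j <= n -> (grid_pt i j).2 = j :> nat.
Proof. exact: inordK. Qed.

Lemma row_seg_connected i q : i <= m -> q <= n.+1 ->
  connected_in (@adjacent (grid m n)) (row_seg i q).
Proof.
move=> im qn; apply: (@connected_in_path _ _ (grid_pt i) q).
- exact: (@adjacent_sym (grid m n)).
- by move=> u; rewrite inE => /andP[/eqP<- uq]; exists (u.2 : nat) => //;
     exact: grid_ptK.
- by move=> j jq; rewrite inE grid_pt1 // grid_pt2 ?eqxx // -ltnS (leq_trans jq).
- move=> j jq; rewrite adjacent_grid grid_relE !grid_pt1 // !grid_pt2 //; lia.
Qed.

Lemma col_seg_connected j p : j <= n -> p <= m.+1 ->
  connected_in (@adjacent (grid m n)) (col_seg j p).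
Proof.
move=> jn pm; apply: (@connected_in_path _ _ (grid_pt^~ j) p).
- exact: (@adjacent_sym (grid m n)).
- by move=> u; rewrite inE => /andP[/eqP<- up]; exists (u.1 : nat) => //;
     exact: grid_ptK.
- by move=> i ip; rewrite inE grid_pt2 // grid_pt1 ?eqxx // -ltnS (leq_trans ip).
- move=> i ip; rewrite adjacent_grid grid_relE !grid_pt2 // !grid_pt1 //; lia.
Qed.

Lemma mem_cross p q i j a b : p <= m.+1 -> q <= n.+1 -> a < p -> b < q ->
  (grid_pt a b \in cross p q i j) = (a == i) || (b == j).
Proof.
move=> pm qn ap bq; rewrite !inE grid_pt1 ?grid_pt2 ?ap ?bq ?andbT //; lia.
Qed.

Lemma cross_connected p q i j : p <= m.+1 -> q <= n.+1 -> i < p -> j < q ->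
  connected_in (@adjacent (grid m n)) (cross p q i j).
Proof.
move=> pm qn ip jq; apply: connected_inU.
- by apply: row_seg_connected => //; lia.
- by apply: col_seg_connected => //; lia.
- apply/set0Pn; exists (grid_pt i j).
  rewrite !inE grid_pt1 ?grid_pt2 ?eqxx ?ip ?jq //; lia.
Qed.

Lemma crosses_meet p q i j i' j' : p <= m.+1 -> q <= n.+1 -> i < p -> j < q ->
  i' < p -> j' < q -> cross p q i j :&: cross p q i' j' != set0.
Proof.
move=> pm qn ip jq ip' jq'; apply/set0Pn; exists (grid_pt i j').
by rewrite inE !mem_cross // !eqxx orbT.
Qed.

Lemma widen_inj p q (pq : p <= q) : injective (widen_ord pq).
Proof. by move=> a b /(congr1 val) /= /val_inj. Qed.

(* A set that avoids a row and a column avoids their cross. *)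
Lemma card_hit_crosses p q (X : {set grid_vertex m n}) :
    p <= m.+1 -> q <= n.+1 -> p <= q ->
    (forall i j, i < p -> j < q -> cross p q i j :&: X != set0) ->
  p <= #|[set u : grid_vertex m n in X | (u.1 < p) && (u.2 < q)]|.
Proof.
move=> pm qn pq hX; set Y := [set u in X | _].
have [rows|] := boolP [forall i : 'I_p, exists u in Y, u.1 == i :> nat].
  pose g (u : grid_vertex m n) := u.1.
  have /leq_trans-> // : p <= #|g @: Y|; last exact: leq_imset_card.
  rewrite -[leqLHS]card_ord -(card_imset _ (@widen_inj _ _ pm)).
  apply/subset_leq_card/subsetP => _ /imsetP[i _ ->].
  have /exists_inP[u uY /eqP ui] := forallP rows i.
  by apply/imsetP; exists u => //; apply: val_inj.
rewrite negb_forall => /existsP[i ni].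
apply: (leq_trans pq); pose g (u : grid_vertex m n) := u.2.
have /leq_trans-> // : q <= #|g @: Y|; last exact: leq_imset_card.
rewrite -[leqLHS]card_ord -(card_imset _ (@widen_inj _ _ qn)).
apply/subset_leq_card/subsetP => _ /imsetP[j _ ->].
(* Row [i] contains no point of [Y], so its cross with column [j] is hit in that column. *)
have /set0Pn[u] := hX _ _ (ltn_ord i) (ltn_ord j).
rewrite !inE => /andP[/orP[/andP[ui uq]|/andP[uj up]] uX].
  by case/exists_inP: ni; exists u => //; rewrite inE uX uq (eqP ui) ltn_ord.
apply/imsetP; exists u; first by rewrite inE uX up (eqP uj) /=.
by apply: val_inj; rewrite /= -(eqP uj).
Qed.

Definition crosses p q : {set {set grid_vertex m n}} :=
  [set cross p q i j | i : 'I_p, j : 'I_q].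

Lemma crosses_hit_card p q (X : {set grid_vertex m n}) :
    p <= m.+1 -> q <= n.+1 -> p <= q ->
    {in crosses p q, forall B : {set grid_vertex m n}, B :&: X != set0} ->
  p <= #|[set u : grid_vertex m n in X | (u.1 < p) && (u.2 < q)]|.
Proof.
move=> pm qn pq hX; apply: card_hit_crosses => // i j ip jq.
by apply: hX; apply/imset2P; exists (Ordinal ip) (Ordinal jq).
Qed.

Lemma grid_clique_lower (H : rel (grid_vertex m n)) : m <= n -> 0 < n ->
  chordal_extension (G := grid m n) H -> m.+2 <= clique_number H.
Proof.
move=> mn n0 [H_sym H_irr H_chordal GH].
have clique_le K : clique H K -> #|K| <= clique_number H.
  by move=> cK; apply: (leq_bigmax_cond (F := fun K : {set _} => #|K|)).
have GH' u v : grid_rel u v -> H u v by rewrite -adjacent_grid; exact: GH.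
(* For [m = 0] the set [C] below would be empty; an edge is then a clique of the required size 2. *)
have [m0|m0] := posnP m.
  have h : H (grid_pt 0 0) (grid_pt 0 1).
    by apply: GH'; rewrite grid_relE !grid_pt1 // !grid_pt2.
  have ne : grid_pt 0 0 != grid_pt 0 1 by apply: contraTneq h => ->; rewrite H_irr.
  apply: leq_trans (clique_le [set grid_pt 0 0; grid_pt 0 1] _).
    by rewrite cards2 ne [X in X.+2]m0.
  apply/forall_inP => x /set2P[]->; apply/forall_inP => y /set2P[]->;
    by rewrite ?eqxx // ?[H (grid_pt 0 1) _]H_sym h implybT.
(* [R] takes the corner and [C] stops short of it, so [R], [C] and the [m] by [n] subgrid are
   disjoint. *)
pose R := row_seg m n.+1; pose C := col_seg n m.
pose Bs := [set R; C] :|: crosses m n.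
have mm : m <= m.+1 := leqnSn m.
have nn : n <= n.+1 := leqnSn n.
have [K [cK hK]] : exists K, clique H K /\
    {in Bs, forall B : {set grid_vertex m n}, B :&: K != set0}.
  apply: (@bramble_clique _ H setT) => //.
    move=> B BBs; rewrite subsetT; split=> //.
      case/setUP: BBs => [/set2P[]->|/imset2P[i j _ _ ->]]; apply/set0Pn.
      - by exists (grid_pt m 0); rewrite inE grid_pt1 // grid_pt2 // eqxx.
      - by exists (grid_pt 0 n); rewrite inE grid_pt1 // grid_pt2 // eqxx.
      - by exists (grid_pt i j); rewrite mem_cross // eqxx.
    apply: (connected_in_subrel GH).
    case/setUP: BBs => [/set2P[]->|/imset2P[i j _ _ ->]].
    - exact: row_seg_connected.
    - exact: col_seg_connected.
    - exact: cross_connected.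
  have self (B : {set grid_vertex m n}) (u : grid_vertex m n) :
      u \in B -> touching H B B.
    by move=> uB; exists u, u; rewrite eqxx.
  have RC : touching H R C.
    exists (grid_pt m n), (grid_pt m.-1 n).
    rewrite !inE !grid_pt1 ?grid_pt2 //; try lia.
    split; [lia|lia|]; apply/orP; right; apply: GH'.
    rewrite grid_relE !grid_pt1 ?grid_pt2 //; lia.
  have RX (i : 'I_m) (j : 'I_n) : touching H R (cross m n i j).
    exists (grid_pt m j), (grid_pt m.-1 j); split.
    - rewrite inE grid_pt1 ?grid_pt2 //; have := ltn_ord j; lia.
    - rewrite mem_cross ?eqxx ?orbT //; lia.
    - apply/orP; right; apply: GH'; have := ltn_ord j => jn.
      rewrite grid_relE !grid_pt1 ?grid_pt2 //; lia.
  have CX (i : 'I_m) (j : 'I_n) : touching H C (cross m n i j).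
    exists (grid_pt i n), (grid_pt i n.-1); split.
    - rewrite inE grid_pt1 ?grid_pt2 //; have := ltn_ord i; lia.
    - rewrite mem_cross ?eqxx //; lia.
    - apply/orP; right; apply: GH'; have := ltn_ord i => im.
      rewrite grid_relE !grid_pt1 ?grid_pt2 //; lia.
  have XX (i i' : 'I_m) (j j' : 'I_n) : touching H (cross m n i j) (cross m n i' j').
    have /set0Pn[u /setIP[u1 u2]] :=
      crosses_meet mm nn (ltn_ord i) (ltn_ord j) (ltn_ord i') (ltn_ord j').
    by exists u, u; rewrite eqxx.
  have RR : touching H R R.
    by apply: (self _ (grid_pt m 0)); rewrite inE grid_pt1 // grid_pt2 // eqxx.
  have CC : touching H C C.
    by apply: (self _ (grid_pt 0 n)); rewrite inE grid_pt1 // grid_pt2 // eqxx.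
  move=> B B' /setUP[/set2P[]->|/imset2P[i j _ _ ->]]
    /setUP[/set2P[]->|/imset2P[i' j' _ _ ->]] //; exact: touching_sym.
apply: leq_trans (clique_le K cK).
have hX : m <= #|[set u : grid_vertex m n in K | (u.1 < m) && (u.2 < n)]|.
  by apply: crosses_hit_card => // B BX; apply: hK; rewrite inE BX orbT.
have /set0Pn[r /setIP[rR rK]] : R :&: K != set0 by apply: hK; rewrite !inE eqxx.
have /set0Pn[c /setIP[cC cK']] : C :&: K != set0.
  by apply: hK; rewrite !inE eqxx orbT.
(* [r] and [c] are distinct and outside the subgrid, so they add 2 to the [m] clique vertices found
   there. *)
move: rR cC; rewrite !inE => /andP[/eqP r1 r2] /andP[/eqP c2 c1].
rewrite (cardsD1 r) rK (cardsD1 c) !inE cK' andbT.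
have -> : c != r by apply/eqP => cr; move: c1; rewrite cr r1 ltnn.
rewrite add1n add1n !ltnS; apply: leq_trans hX _; apply/subset_leq_card/subsetP => u.
rewrite !inE => /and3P[-> u1 u2]; rewrite andbT; apply/andP; split.
  by apply: contraTneq u2 => ->; rewrite c2 ltnn.
by apply: contraTneq u1 => ->; rewrite r1 ltnn.
Qed.

Definition column_index u : nat := u.2 * m.+1 + u.1.

Lemma column_index_inj : injective column_index.
Proof.
move=> [a b] [a' b'] /= E; congr (_, _); apply: val_inj => /=.
  by have := congr1 (modn^~ m.+1) E; rewrite /column_index /= !modnMDl !modn_small.
have := congr1 (divn^~ m.+1) E.
by rewrite /column_index /= !divnMDl // !divn_small // !addn0.
Qed.

(** Neighbours in a column have indices differing by 1, neighbours in a row by [m.+1]. *)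
Lemma grid_band_extension :
  chordal_extension (G := grid m n) (band column_index m.+1).
Proof.
split; [exact: band_sym|exact: band_irr|exact: band_chordal|].
move=> u v; rewrite adjacent_grid => uv; apply/and3P; split.
- by apply: contraTneq uv => ->; rewrite grid_relE; lia.
- move: uv; rewrite grid_relE /column_index; nia.
- move: uv; rewrite grid_relE /column_index; nia.
Qed.

(** The condition [0 < n] excludes the one-vertex grid, whose treewidth is 0. *)
Lemma grid_treewidth : m <= n -> 0 < n -> is_treewidth (grid m n) (m%:Z + 1)%R.
Proof.
move=> mn n0; exists (m.+2%:Z)%R; split; last by lia.
split.
  exists (band column_index m.+1); split; first exact: grid_band_extension.
  congr (Posz _); apply/eqP; rewrite eqn_leq grid_clique_lower ?andbT //.
    exact/band_clique_number/column_index_inj.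
  exact: grid_band_extension.
by move=> _ [H [HE <-]]; rewrite lez_nat; exact: grid_clique_lower.
Qed.

Local Open Scope ring_scope.

(** * Column divisors and gonality *)

Definition column_divisor (j : nat) : divisor (grid m n) :=
  [ffun u : grid_vertex m n => (u.2 == j :> nat)%:Z].

Lemma eq_grid_pt i j v : (i <= m)%N -> (j <= n)%N ->
  (v == grid_pt i j) = (v.1 == i :> nat) && (v.2 == j :> nat).
Proof.
case: v => a b im jn; rewrite xpair_eqE -!val_eqE /= !inordK //.
Qed.

(** When columns 0 to [j] are fired, chips move only between columns [j] and [j.+1]. Writing the
    flow with a single possible [v] in each term lets the sum over [v] collapse in
    [column_divisor_step]. *)
Lemma grid_flow j u v : (j < n)%N ->
  (grid_rel u v)%:Z * ((u.2 <= j)%N%:Z - (v.2 <= j)%N%:Z) =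
  (if v == grid_pt u.1 j.+1 then (u.2 == j :> nat)%:Z else 0) -
  (if v == grid_pt u.1 j then (u.2 == j.+1 :> nat)%:Z else 0).
Proof.
move=> jn; have um : (u.1 <= m)%N by rewrite -ltnS.
rewrite !eq_grid_pt ?(ltnW jn) // grid_relE.
move: (nat_of_ord u.1) (nat_of_ord u.2) (nat_of_ord v.1) (nat_of_ord v.2) => a b c d.
case: ifPn; case: ifPn; case: (boolP (_ || _)); rewrite /= ?mul0r ?mul1r; lia.
Qed.

Lemma column_divisor_step j :
  (j < n)%N -> equivalent (column_divisor j) (column_divisor j.+1).
Proof.
move=> jn; pose f : divisor (grid m n) :=
  [ffun u : grid_vertex m n => (u.2 <= j)%N%:Z].
exists f; apply/ffunP => u; rewrite laplacian_mulE divisorB !ffunE.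
under eq_bigr => v _ do rewrite card_edges_between_grid !ffunE grid_flow //.
by rewrite sumrB -!big_mkcond !big_pred1_eq.
Qed.

Lemma column_divisor_equivalent j :
  (j <= n)%N -> equivalent (column_divisor 0) (column_divisor j).
Proof.
elim: j => [_|j IH jn]; first exact: equivalent_refl.
by apply: equivalent_trans (IH (ltnW jn)) _; exact: column_divisor_step.
Qed.

Lemma deg_column_divisor : deg (column_divisor 0) = m%:Z + 1.
Proof.
rewrite /deg; under eq_bigr => u _ do rewrite ffunE.
rewrite -(pair_bigA _ (fun (_ : 'I_m.+1) (b : 'I_n.+1) => (b == 0%N :> nat)%:Z)) /=.
have one : \sum_(b < n.+1) (b == 0%N :> nat)%:Z = 1.
  by rewrite big_ord_recl /= big1 ?addr0.
under eq_bigr do rewrite one.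
by rewrite sumr_const card_ord; lia.
Qed.

Lemma column_divisor_positive_rank : positive_rank (column_divisor 0).
Proof.
apply: (@reach_positive_rank (grid m n) _ (grid_pt 0 0)).
  by rewrite deg_column_divisor; lia.
move=> v; exists (column_divisor (v : grid_vertex m n).2); split.
- by move=> u; rewrite ffunE.
- by apply: column_divisor_equivalent; rewrite -ltnS.
- by rewrite ffunE eqxx.
Qed.

Lemma grid_gonality : (m <= n)%N -> is_gonality (grid m n) (m%:Z + 1).
Proof.
move=> mn; split.
  exists (column_divisor 0); split; first exact: deg_column_divisor.
  exact: column_divisor_positive_rank.
move=> _ [D [<- rkD]].
(* The crosses of the whole grid are used; the support of the resulting [E] meets all of them. *)
have [|| E [E0 DE hE]] :=
  @strict_bramble_hit (grid m n) D (crosses m.+1 n.+1) (grid_pt 0 0) _ _ rkD.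
- by move=> _ /imset2P[i j _ _ ->]; exact: cross_connected.
- by move=> _ _ /imset2P[i j _ _ ->] /imset2P[i' j' _ _ ->]; exact: crosses_meet.
rewrite (equivalent_deg DE); apply: le_trans (card_support_le_deg E0).
pose X : {set grid_vertex m n} := [set v | (0 < E v)%R].
have : (m.+1 <= #|[set u : grid_vertex m n in X | (u.1 < m.+1) && (u.2 < n.+1)]|)%N.
  apply: crosses_hit_card => // B BX; have /exists_inP[u uB Eu] := hE _ BX.
  by apply/set0Pn; exists u; rewrite !inE uB.
move=> le1; have le2 : (m.+1 <= #|X|)%N.
  apply: leq_trans le1 _; apply/subset_leq_card/subsetP => u.
  by rewrite !inE => /andP[].
by rewrite -PoszD addn1 lez_nat.
Qed.

End Grid.

Local Open Scope ring_scope.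

Theorem mainTheorem3 (m n : nat) (hmn : (m <= n)%N) (hn : (0 < n)%N) :
  is_gonality (grid m n) (m%:Z + 1) /\ is_treewidth (grid m n) (m%:Z + 1).
Proof. by split; [exact: grid_gonality|exact: grid_treewidth]. Qed.
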